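(* Let $k$ be an algebraically closed field and $A$ a Hopf $k$-algebra with bijective antipode. Let $\Pi$ be a set of $k$-algebra homomorphisms $A\to k$ such that the subgroup $\langle\Pi\rangle$ generated by $\Pi$ in $G(A^\circ)$ is finite and abelian, and such that $|\langle\Pi\rangle|$ is coprime to the characteristic $p$ of $k$ when $p>0$. Then: (a) $\Delta(A^l_{\Pi,\chi})\subseteq A^l_{\Pi,\chi}\otimes A$ for all $\chi\in\widehat{G^l_\Pi}$. (b) $A=\bigoplus_{\chi\in\widehat{G^l_\Pi}}A^l_{\Pi,\chi}$ is strongly $\widehat{G^l_\Pi}$-graded.
   Context: $G(A^\circ)=\mathrm{Hom}_{k\text{-alg}}(A,k)$ is a group under convolution. For an algebra homomorphism $\pi:A\to k$, the left winding automorphism is $\Xi^l_\pi(a)=\sum\pi(a_1)a_2$, where $\Delta(a)=\sum a_1\otimes a_2$. $G^l_\Pi$ is the subgroup of $\mathrm{Aut}_{k\text{-alg}}(A)$ generated by $\{\Xi^l_\pi:\pi\in\Pi\}$; under the hypotheses it is a finite abelian group isomorphic to $\langle\Pi\rangle$. $\widehat{G^l_\Pi}$ is its group of characters $G^l_\Pi\to k^\times$, written additively, and for $\chi\in\widehat{G^l_\Pi}$ we set $A^l_{\Pi,\chi}=\{a\in A: g(a)=\chi(g)a\ \ \forall g\in G^l_\Pi\}$. A grading $A=\bigoplus_{\gamma\in\Gamma}A_\gamma$ by a group $\Gamma$ is strong if $A_\gamma A_{\delta}=A_{\gamma+\delta}$ for all $\gamma,\delta\in\Gamma$. *)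

(* Defs.v *)
From HB Require Import structures.
From mathcomp Require Import all_boot all_order all_algebra finmap generic_quotient.
From mathcomp Require Import ring.
From mathcomp Require Import boolp classical_sets cardinality.

Set Implicit Arguments.
Unset Strict Implicit.
Unset Printing Implicit Defensive.

Import GRing.Theory.

Local Open Scope classical_set_scope.
Local Open Scope quotient_scope.
Local Open Scope ring_scope.

(* V (x) W is the quotient of the free commutative monoid on V * W by the
   congruence below.  It is a group because (- v) (x) w is the opposite of
   v (x) w, hence this is the usual tensor product over k. *)
Inductive tensor_equiv (k : fieldType) (V W : lmodType k) :
    seq (V * W) -> seq (V * W) -> Prop :=
| TensorRefl s : tensor_equiv s s
| TensorSym s t : tensor_equiv s t -> tensor_equiv t s
| TensorTrans s t u :
    tensor_equiv s t -> tensor_equiv t u -> tensor_equiv s u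
| TensorCat s s' t t' :
    tensor_equiv s s' -> tensor_equiv t t' -> tensor_equiv (s ++ t) (s' ++ t')
| TensorCatC s t : tensor_equiv (s ++ t) (t ++ s)
| Tensor0 w : tensor_equiv [:: (0, w)] [::]
| TensorDl v v' w : tensor_equiv [:: (v + v', w)] [:: (v, w); (v', w)]
| TensorDr v w w' : tensor_equiv [:: (v, w + w')] [:: (v, w); (v, w')]
| TensorZ (c : k) v w : tensor_equiv [:: (c *: v, w)] [:: (v, c *: w)].

Section Tensor.
Variables (k : fieldType) (V W : lmodType k).

Definition tensor_equivb : rel (seq (V * W)) :=
  fun s t => `[< tensor_equiv s t >].

Lemma tensor_equivb_refl : reflexive tensor_equivb.
Proof. by move=> s; apply/asboolP; apply: TensorRefl. Qed.

Lemma tensor_equivb_sym : symmetric tensor_equivb.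
Proof.
by move=> s t; apply/asboolP/asboolP => h; apply: TensorSym.
Qed.

Lemma tensor_equivb_trans : transitive tensor_equivb.
Proof.
move=> t s u /asboolP st /asboolP tu.
by apply/asboolP; apply: TensorTrans tu.
Qed.

Canonical tensor_equiv_rel := EquivRel tensor_equivb
  tensor_equivb_refl tensor_equivb_sym tensor_equivb_trans.

Definition tensor := {eq_quot tensor_equiv_rel}.

HB.instance Definition _ := Choice.on tensor.
HB.instance Definition _ := EqQuotient.on tensor.


Definition tensor_of (s : seq (V * W)) : tensor := \pi_tensor s.

Lemma tensor_ofP s t : tensor_of s = tensor_of t <-> tensor_equiv s t.
Proof.
split=> [/eqP|h]; first by rewrite piE => /asboolP.
by apply/eqP; rewrite piE; apply/asboolP.
Qed.

Lemma repr_tensor_of s : tensor_equiv (repr (tensor_of s)) s.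
Proof. by apply/tensor_ofP; rewrite /tensor_of reprK. Qed.

Lemma tensor_ofK (t : tensor) : tensor_of (repr t) = t.
Proof. exact: reprK. Qed.

Definition scale_terms (c : k) (s : seq (V * W)) : seq (V * W) :=
  [seq (c *: p.1, p.2) | p <- s].

Lemma scale_terms_equiv c s t :
  tensor_equiv s t -> tensor_equiv (scale_terms c s) (scale_terms c t).
Proof.
elim=> /=.
- by move=> ?; exact: TensorRefl.
- by move=> ? ? _; exact: TensorSym.
- by move=> ? ? ? _ h1 _; exact: TensorTrans h1.
- by move=> *; rewrite /scale_terms !map_cat; exact: TensorCat.
- by move=> *; rewrite /scale_terms !map_cat; exact: TensorCatC.
- by move=> w; rewrite scaler0; exact: Tensor0.
- by move=> *; rewrite scalerDr; exact: TensorDl.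
- by move=> *; exact: TensorDr.
- by move=> d v w; rewrite scalerA mulrC -scalerA; exact: TensorZ.
Qed.

Definition tensor_add (t u : tensor) : tensor :=
  tensor_of (repr t ++ repr u).
Definition tensor_scale (c : k) (t : tensor) : tensor :=
  tensor_of (scale_terms c (repr t)).
Definition tensor_opp (t : tensor) : tensor := tensor_scale (-1) t.
Definition tensor_zero : tensor := tensor_of [::].

Lemma tensor_add_of s t :
  tensor_add (tensor_of s) (tensor_of t) = tensor_of (s ++ t).
Proof. by apply/tensor_ofP; apply: TensorCat; exact: repr_tensor_of. Qed.

Lemma tensor_scale_of c s :
  tensor_scale c (tensor_of s) = tensor_of (scale_terms c s).
Proof.
by apply/tensor_ofP; apply: scale_terms_equiv; exact: repr_tensor_of.
Qed.

Lemma tensor_addA : associative tensor_add.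
Proof.
move=> t u v; rewrite -(tensor_ofK t) -(tensor_ofK u) -(tensor_ofK v).
by rewrite !tensor_add_of catA.
Qed.

Lemma tensor_addC : commutative tensor_add.
Proof.
move=> t u; rewrite -(tensor_ofK t) -(tensor_ofK u) !tensor_add_of.
by apply/tensor_ofP; exact: TensorCatC.
Qed.

Lemma tensor_add0 : left_id tensor_zero tensor_add.
Proof. by move=> t; rewrite -(tensor_ofK t) tensor_add_of. Qed.

Lemma tensor_of_cons p s :
  tensor_of (p :: s) = tensor_add (tensor_of [:: p]) (tensor_of s).
Proof. by rewrite tensor_add_of. Qed.

Lemma tensor_scaleDl_of c d s :
  tensor_of (scale_terms (c + d) s) =
  tensor_of (scale_terms c s ++ scale_terms d s).
Proof.
rewrite -[RHS]tensor_add_of.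
elim: s => [|p s IH]; first by rewrite tensor_add0.
rewrite /= (tensor_of_cons _ (scale_terms _ s)) IH scalerDl.
rewrite (tensor_of_cons (c *: p.1, _)) (tensor_of_cons (d *: p.1, _)).
have -> : tensor_of [:: (c *: p.1 + d *: p.1, p.2)] =
    tensor_add (tensor_of [:: (c *: p.1, p.2)]) (tensor_of [:: (d *: p.1, p.2)]).
  by rewrite tensor_add_of; apply/tensor_ofP; exact: TensorDl.
rewrite -!tensor_addA; congr tensor_add.
rewrite !tensor_addA; congr tensor_add; exact: tensor_addC.
Qed.

Lemma tensor_scaleDl (t : tensor) (c d : k) :
  tensor_scale (c + d) t = tensor_add (tensor_scale c t) (tensor_scale d t).
Proof.
by rewrite -(tensor_ofK t) !tensor_scale_of tensor_add_of tensor_scaleDl_of.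
Qed.

Lemma tensor_scale0 t : tensor_scale 0 t = tensor_zero.
Proof.
rewrite -(tensor_ofK t) tensor_scale_of; elim: (repr t) => [//|p s IH] /=.
rewrite -cat1s -tensor_add_of IH scale0r tensor_addC tensor_add0.
by apply/tensor_ofP; exact: Tensor0.
Qed.

Lemma tensor_scale1 : left_id 1 tensor_scale.
Proof.
move=> t; rewrite -{1}(tensor_ofK t) tensor_scale_of -[RHS]tensor_ofK.
by congr tensor_of; rewrite -[RHS]map_id; apply: eq_map => -[v w];
  rewrite /= scale1r.
Qed.

Lemma tensor_scaleA (c d : k) t :
  tensor_scale c (tensor_scale d t) = tensor_scale (c * d) t.
Proof.
rewrite -(tensor_ofK t) !tensor_scale_of; congr tensor_of.
by rewrite /scale_terms -map_comp; apply: eq_map => -[v w] /=; rewrite scalerA.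
Qed.

Lemma tensor_scaleDr : right_distributive tensor_scale tensor_add.
Proof.
move=> c t u; rewrite -(tensor_ofK t) -(tensor_ofK u).
by rewrite !(tensor_add_of, tensor_scale_of) /scale_terms map_cat.
Qed.

Lemma tensor_addN : left_inverse tensor_zero tensor_opp tensor_add.
Proof.
move=> t; rewrite -{2}[t]tensor_scale1 -tensor_scaleDl addNr.
exact: tensor_scale0.
Qed.

HB.instance Definition _ := GRing.isZmodule.Build tensor
  tensor_addA tensor_addC tensor_add0 tensor_addN.

HB.instance Definition _ := GRing.Zmodule_isLmodule.Build k tensor
  tensor_scaleA tensor_scale1 tensor_scaleDr tensor_scaleDl.

End Tensor.

Arguments tensor_of {k V W} s.

Definition pure_tensor (k : fieldType) (V W : lmodType k) (v : V) (w : W) :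
  tensor V W := tensor_of [:: (v, w)].

Notation "V ⊗ W" := (tensor V%type W%type)
  (at level 40, left associativity) : type_scope.
Notation "v ⊗ w" := (pure_tensor v w)
  (at level 40, left associativity) : ring_scope.

Definition bilinear_fun (k : fieldType) (V W U : lmodType k)
    (f : V -> W -> U) : Prop :=
  (forall w, linear (f^~ w)) /\ (forall v, linear (f v)).

(* The linear map V ⊗ W -> U induced by f; it is only meaningful for a
   bilinear f, since it is computed on a chosen representative. *)
Definition tensor_lift (k : fieldType) (V W U : lmodType k)
    (f : V -> W -> U) (t : V ⊗ W) : U :=
  \sum_(p <- repr t) f p.1 p.2.

Lemma linearP_sum (k : fieldType) (U U' : lmodType k) (h : U -> U') :
  linear h -> forall (I : Type) (r : seq I) (F : I -> U),
  h (\sum_(i <- r) F i) = \sum_(i <- r) h (F i).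
Proof.
move=> hl I r F.
pose H := GRing.isLinear.Build k U U' *:%R h hl.
pose hL : {linear U -> U'} := HB.pack h H.
exact: (linear_sum hL).
Qed.

Lemma linearP_add (k : fieldType) (U U' : lmodType k) (h : U -> U') :
  linear h -> {morph h : x y / x + y}.
Proof. by move=> hl x y; rewrite -[x]scale1r hl !scale1r. Qed.

Lemma linearP_0 (k : fieldType) (U U' : lmodType k) (h : U -> U') :
  linear h -> h 0 = 0.
Proof.
move=> hl; apply: (@addrI _ (h 0)).
by rewrite -(linearP_add hl) !addr0.
Qed.

Lemma linearP_scale (k : fieldType) (U U' : lmodType k) (h : U -> U') :
  linear h -> forall c x, h (c *: x) = c *: h x.
Proof. by move=> hl c x; rewrite -[c *: x]addr0 hl (linearP_0 hl) addr0. Qed.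

Section TensorLift.
Variables (k : fieldType) (V W U : lmodType k).
Implicit Types (f : V -> W -> U).

Lemma tensor_lift_equiv f s t : bilinear_fun f -> tensor_equiv s t ->
  \sum_(p <- s) f p.1 p.2 = \sum_(p <- t) f p.1 p.2.
Proof.
move=> [fl fr]; elim=> {s t} //.
- by move=> s t u _ -> _ ->.
- by move=> s s' t t' _ h _ h'; rewrite !big_cat /= h h'.
- by move=> s t; rewrite !big_cat /= addrC.
- by move=> w; rewrite big_cons !big_nil /= (linearP_0 (fl w)) addr0.
- by move=> v v' w; rewrite !big_cons !big_nil !addr0 /= (linearP_add (fl w)).
- by move=> v w w'; rewrite !big_cons !big_nil !addr0 /= (linearP_add (fr v)).
- by move=> c v w; rewrite !big_cons !big_nil !addr0 /= (linearP_scale (fl w)) (linearP_scale (fr v)).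
Qed.

Lemma tensor_lift_of f s : bilinear_fun f ->
  tensor_lift f (tensor_of s) = \sum_(p <- s) f p.1 p.2.
Proof. by move=> fb; apply: tensor_lift_equiv => //; exact: repr_tensor_of. Qed.

Lemma tensor_lift_pure f v w : bilinear_fun f -> tensor_lift f (v ⊗ w) = f v w.
Proof. by move=> fb; rewrite tensor_lift_of // big_cons big_nil addr0. Qed.

Lemma tensor_lift_linear f : bilinear_fun f -> linear (tensor_lift f).
Proof.
move=> fb c t u; rewrite -(tensor_ofK t) -(tensor_ofK u).
rewrite -[c *: _]/(tensor_scale c _) -[_ + _ in LHS]/(tensor_add _ _).
rewrite tensor_scale_of tensor_add_of !tensor_lift_of // big_cat big_map /=.
rewrite scaler_sumr; congr (_ + _); apply: eq_bigr => p _ /=.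
by rewrite (linearP_scale (fb.1 p.2)).
Qed.

Lemma pure_tensor_bilinear : bilinear_fun (@pure_tensor k V W).
Proof.
split=> [w c v v' | v c w w'].
- rewrite -[c *: _ in RHS]/(tensor_scale c _) -[_ + _ in RHS]/(tensor_add _ _).
  by rewrite tensor_scale_of tensor_add_of; apply/tensor_ofP; exact: TensorDl.
- rewrite -[c *: _ in RHS]/(tensor_scale c _) -[_ + _ in RHS]/(tensor_add _ _).
  rewrite tensor_scale_of tensor_add_of; apply/tensor_ofP.
  apply: TensorTrans (TensorDr _ _ _) _.
  rewrite -cat1s; apply: TensorCat; last exact: TensorRefl.
  exact/TensorSym/TensorZ.
Qed.

Lemma tensor_sumE (t : V ⊗ W) : t = \sum_(p <- repr t) p.1 ⊗ p.2.
Proof.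
rewrite -{1}(tensor_ofK t); elim: (repr t) => [|p s IH]; first by rewrite big_nil.
by rewrite big_cons -IH tensor_of_cons; case: p.
Qed.

End TensorLift.

Definition tensor_map (k : fieldType) (V W V' W' : lmodType k)
    (f : V -> V') (g : W -> W') : V ⊗ W -> V' ⊗ W' :=
  tensor_lift (fun v w => f v ⊗ g w).

Definition tensor_assoc (k : fieldType) (V W U : lmodType k) :
    (V ⊗ W) ⊗ U -> V ⊗ (W ⊗ U) :=
  tensor_lift (fun t u => tensor_lift (fun v w => v ⊗ (w ⊗ u)) t).

Definition tensor_mul (k : fieldType) (A B : algType k) (t u : A ⊗ B) : A ⊗ B :=
  tensor_lift (fun a b => tensor_lift (fun a' b' => (a * a') ⊗ (b * b')) u) t.

HB.mixin Record isCoalgebra (k : fieldType) C of GRing.Lmodule k C := {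
  comul : {linear C -> (C ⊗ C)%type};
  counit : {linear C -> k^o};
  comulA : forall c, tensor_assoc (tensor_map comul idfun (comul c)) =
                     tensor_map idfun comul (comul c);
  counit_comul : forall c, tensor_lift (fun x y => counit x *: y) (comul c) = c;
  comul_counit : forall c, tensor_lift (fun x y => counit y *: x) (comul c) = c
}.

#[short(type="coalgType")]
HB.structure Definition Coalgebra (k : fieldType) :=
  {C of isCoalgebra k C & GRing.Lmodule k C}.

HB.mixin Record isBialgebra (k : fieldType) A
    of Coalgebra k A & GRing.Algebra k A := {
  comulM : forall a b : A, comul (a * b) = tensor_mul (comul a) (comul b);
  comul1 : comul (1 : A) = 1 ⊗ 1;
  counitM : forall a b : A, counit (a * b) = counit a * counit b;
  counit1 : counit (1 : A) = 1
}.

#[short(type="bialgType")]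
HB.structure Definition Bialgebra (k : fieldType) :=
  {A of isBialgebra k A & Coalgebra k A & GRing.Algebra k A}.

HB.mixin Record isHopf (k : fieldType) A of Bialgebra k A := {
  antipode : {linear A -> A};
  antipodel : forall a : A,
    tensor_lift (fun x y => antipode x * y) (comul a) = (counit a)%:A;
  antipoder : forall a : A,
    tensor_lift (fun x y => x * antipode y) (comul a) = (counit a)%:A
}.

#[short(type="hopfAlgType")]
HB.structure Definition HopfAlgebra (k : fieldType) :=
  {A of isHopf k A & Bialgebra k A}.

(* sweedler f a is the sum of the f a_1 a_2, where comul a is the sum of the
   a_1 ⊗ a_2. *)
Definition sweedler (k : fieldType) (C : coalgType k) (U : lmodType k)
    (f : C -> C -> U) (c : C) : U := tensor_lift f (comul c).

Lemma lrmorphism_ext (k : fieldType) (A B : algType k)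
    (f g : {lrmorphism A -> B}) : f =1 g -> f = g.
Proof.
case: f => f [[f1] [f2] [f3]]; case: g => g [[g1] [g2] [g3]] /= /funext fg.
by subst g; rewrite (Prop_irrelevance f1 g1) (Prop_irrelevance f2 g2)
  (Prop_irrelevance f3 g3).
Qed.

Section SweedlerCoalgebra.
Variables (k : fieldType) (C : coalgType k) (U : lmodType k).

Lemma eq_tensor_lift (V W : lmodType k) (f g : V -> W -> U) t :
  (forall v w, f v w = g v w) -> tensor_lift f t = tensor_lift g t.
Proof. by move=> fg; apply: eq_bigr. Qed.

Lemma sweedler_linear (f : C -> C -> U) : bilinear_fun f -> linear (sweedler f).
Proof.
move=> fb c x y; rewrite /sweedler linearP.
exact: (tensor_lift_linear fb).
Qed.

Lemma sweedlerA (T : C -> C -> C -> U) (a : C) :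
  (forall y z, linear (fun x => T x y z)) ->
  (forall x z, linear (fun y => T x y z)) ->
  (forall x y, linear (fun z => T x y z)) ->
  sweedler (fun x z => sweedler (fun u v => T u v z) x) a =
  sweedler (fun x y => sweedler (fun u v => T x u v) y) a.
Proof.
move=> T1 T2 T3.
have bT x : bilinear_fun (T x) by split=> [z|y]; [exact: T2 | exact: T3].
pose L (x : C) (t : C ⊗ C) : U := tensor_lift (T x) t.
have bL : bilinear_fun L.
  split=> [t c x x'|x]; last exact: tensor_lift_linear.
  rewrite /L /tensor_lift scaler_sumr -big_split /=.
  by apply: eq_bigr => p _; rewrite T1.
have lL := tensor_lift_linear bL.
have bp (z : C) : bilinear_fun (fun v w : C => v ⊗ (w ⊗ z)).
  split=> [w c v v'|v c w w'].
    by rewrite ((pure_tensor_bilinear C (tensor C C)).1 (w ⊗ z)).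
  rewrite ((pure_tensor_bilinear C C).1 z).
  by rewrite ((pure_tensor_bilinear C (tensor C C)).2 v).
have bA : bilinear_fun (fun (t : C ⊗ C) (z : C) =>
    tensor_lift (fun v w => v ⊗ (w ⊗ z)) t).
  split=> [z|t c z z']; first exact: tensor_lift_linear.
  rewrite /tensor_lift scaler_sumr -big_split /=; apply: eq_bigr => p _.
  by rewrite ((pure_tensor_bilinear C C).2 p.2)
             ((pure_tensor_bilinear C (tensor C C)).2 p.1).
have := congr1 (tensor_lift L) (comulA a).
have lA : linear (@tensor_assoc k C C C) := tensor_lift_linear bA.
pose r := repr (comul a).
have -> : tensor_map comul idfun (comul a) = \sum_(p <- r) comul p.1 ⊗ p.2 by [].
have -> : tensor_map idfun comul (comul a) = \sum_(p <- r) p.1 ⊗ comul p.2 by [].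
rewrite (linearP_sum lA) !(linearP_sum lL) => h.
transitivity (\sum_(p <- r) tensor_lift L (tensor_assoc (comul p.1 ⊗ p.2))).
  apply: eq_bigr => p _; rewrite /tensor_assoc (tensor_lift_pure _ _ bA).
  rewrite [X in tensor_lift L X]/tensor_lift (linearP_sum lL).
  apply: eq_bigr => q _.
  by rewrite (tensor_lift_pure _ _ bL) /L (tensor_lift_pure _ _ (bT _)).
rewrite h; apply: eq_bigr => p _.
by rewrite (tensor_lift_pure _ _ bL).
Qed.

End SweedlerCoalgebra.

Section SweedlerBialgebra.
Variables (k : fieldType) (A : bialgType k) (U : lmodType k).

Lemma sweedlerM (f : A -> A -> U) (a b : A) : bilinear_fun f ->
  sweedler f (a * b) =
  sweedler (fun x y => sweedler (fun x' y' => f (x * x') (y * y')) b) a.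
Proof.
move=> fb; rewrite {1}/sweedler comulM /tensor_mul.
have lf := tensor_lift_linear fb.
rewrite {2}/tensor_lift (linearP_sum lf); apply: eq_bigr => p _.
rewrite {2}/tensor_lift (linearP_sum lf); apply: eq_bigr => q _.
exact: tensor_lift_pure.
Qed.

Lemma sweedler1 (f : A -> A -> U) : bilinear_fun f ->
  sweedler f 1 = f 1 1.
Proof. by move=> fb; rewrite /sweedler comul1 tensor_lift_pure. Qed.

End SweedlerBialgebra.

(* The group G(A°) of the algebra homomorphisms A -> k under convolution. *)
Definition alg_char (k : fieldType) (A : algType k) : Type :=
  {lrmorphism A -> k^o}.
HB.instance Definition _ (k : fieldType) (A : algType k) :=
  gen_eqMixin (alg_char A).
HB.instance Definition _ (k : fieldType) (A : algType k) :=
  gen_choiceMixin (alg_char A).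

Definition char_fun (k : fieldType) (A : algType k) (pi : alg_char A) :
  {lrmorphism A -> k^o} := pi.
Coercion char_fun : alg_char >-> GRing.LRMorphism.type.

Lemma regular_scaleE (k : fieldType) (c x : k) : c *: (x : k^o) = c * x.
Proof. by []. Qed.

Section Convolution.
Variables (k : fieldType) (A : hopfAlgType k).
Implicit Types (pi rho sigma : alg_char A).

Lemma alg_char_ext pi rho : (forall a, pi a = rho a) -> pi = rho.
Proof. exact: lrmorphism_ext. Qed.

Lemma bilinear_mul (f g : {linear A -> k^o}) :
  bilinear_fun (fun x y => f x * g y : k^o).
Proof.
split=> [w c v v'|v c w w']; first by rewrite linearP mulrDl scalerAl.
by rewrite linearP mulrDr scalerAr.
Qed.

Definition conv_fun (f g : A -> k^o) (a : A) : k^o :=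
  sweedler (fun x y => f x * g y : k^o) a.

Lemma conv_fun_linear pi rho : linear (conv_fun pi rho).
Proof. exact/sweedler_linear/bilinear_mul. Qed.

Lemma conv_fun_monoid pi rho : monoid_morphism (conv_fun pi rho).
Proof.
split; first by rewrite /conv_fun sweedler1 ?rmorph1 ?mulr1 //; exact: bilinear_mul.
move=> a b; rewrite /conv_fun sweedlerM; last exact: bilinear_mul.
rewrite /sweedler /tensor_lift mulr_suml; apply: eq_bigr => p _.
rewrite mulr_sumr; apply: eq_bigr => q _.
by rewrite !rmorphM mulrACA.
Qed.

HB.instance Definition _ pi rho :=
  GRing.isLinear.Build k A k^o *:%R (conv_fun pi rho) (conv_fun_linear pi rho).
HB.instance Definition _ pi rho :=
  GRing.isMonoidMorphism.Build A k^o (conv_fun pi rho) (conv_fun_monoid pi rho).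

Definition conv pi rho : alg_char A := conv_fun pi rho : {lrmorphism A -> k^o}.

Definition counit_fun (a : A) : k^o := counit a.

HB.instance Definition _ := GRing.Linear.copy counit_fun (counit : A -> k^o).
HB.instance Definition _ := GRing.isMonoidMorphism.Build A k^o counit_fun
  (counit1, counitM).

Definition conv1 : alg_char A := counit_fun : {lrmorphism A -> k^o}.

Lemma convA : associative conv.
Proof.
move=> pi rho sigma; apply: alg_char_ext => a.
pose T x u v : k^o := pi x * rho u * sigma v.
transitivity (sweedler (fun x y => sweedler (fun u v => T x u v) y) a).
  apply: eq_tensor_lift => x y; rewrite [in LHS]/= /conv_fun /sweedler /tensor_lift.
  by rewrite mulr_sumr; apply: eq_bigr => p _; rewrite /T mulrA.
rewrite -sweedlerA.
- by apply: eq_tensor_lift => x y; rewrite [in RHS]/= /conv_fun /sweedler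
    /tensor_lift mulr_suml; apply: eq_bigr.
- by move=> y z c x x'; rewrite /T linearP !regular_scaleE; ring.
- by move=> x z c y y'; rewrite /T linearP !regular_scaleE; ring.
- by move=> x y c z z'; rewrite /T linearP !regular_scaleE; ring.
Qed.

Lemma conv1l : left_id conv1 conv.
Proof.
move=> pi; apply: alg_char_ext => a.
rewrite -[in RHS](counit_comul a) linear_sum; apply: eq_bigr => p _.
by rewrite linearZ.
Qed.

Lemma conv1r : right_id conv1 conv.
Proof.
move=> pi; apply: alg_char_ext => a.
rewrite -[in RHS](comul_counit a) linear_sum; apply: eq_bigr => p _.
by rewrite linearZ /= mulrC.
Qed.

Definition convV_fun pi (a : A) : k^o := pi (antipode a).

Lemma convV_fun_linear pi : linear (convV_fun pi).
Proof. by move=> c a b; rewrite /convV_fun !linearP. Qed.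

Lemma convVl_fun pi a : sweedler (fun x y => convV_fun pi x * pi y : k^o) a = counit a.
Proof.
transitivity (pi (counit a)%:A); last by rewrite linearZ rmorph1 /= /GRing.scale /= mulr1.
by rewrite -antipodel linear_sum; apply: eq_bigr => p _; rewrite rmorphM.
Qed.

Lemma convVr_fun pi a : sweedler (fun x y => pi x * convV_fun pi y : k^o) a = counit a.
Proof.
transitivity (pi (counit a)%:A); last by rewrite linearZ rmorph1 /= /GRing.scale /= mulr1.
by rewrite -antipoder linear_sum; apply: eq_bigr => p _; rewrite rmorphM.
Qed.

HB.instance Definition _ pi :=
  GRing.isLinear.Build k A k^o *:%R (convV_fun pi) (convV_fun_linear pi).

Lemma antipode1 : antipode (1 : A) = 1.
Proof.
have b : bilinear_fun (fun x y : A => antipode x * y).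
  split=> [w c v v'|v c w w']; first by rewrite linearP mulrDl scalerAl.
  by rewrite mulrDr scalerAr.
by have := sweedler1 b; rewrite /sweedler antipodel counit1 scale1r mulr1.
Qed.

Lemma convV_fun_monoid pi : monoid_morphism (convV_fun pi).
Proof.
split; first by rewrite /convV_fun antipode1 rmorph1.
move=> a b.
pose f := convV_fun pi.
(* Both sides are computed from the convolution, in Hom(A ⊗ A, k), of
   f (x * x'), pi (x * x') and f x * f x'. *)
pose T x x' u u' v v' : k^o := f (x * x') * (pi u * pi u') * (f v * f v').
have e1 : sweedler (fun x y => sweedler (fun x' y' =>
    sweedler (fun u v => sweedler (fun u' v' => T x x' u u' v v') y') y) b) a
  = f (a * b).
  transitivity (sweedler (fun x y => sweedler (fun x' y' =>
      f (x * x') * (counit y * counit y') : k^o) b) a).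
    apply: eq_tensor_lift => x y; apply: eq_tensor_lift => x' y'.
    rewrite -!(convVr_fun pi) /sweedler /tensor_lift mulr_suml mulr_sumr.
    apply: eq_bigr => p _; rewrite !mulr_sumr; apply: eq_bigr => q _.
    by rewrite /T -mulrA; congr (_ * _); rewrite mulrACA.
  rewrite -[in RHS](comul_counit a) -[in RHS](comul_counit b).
  rewrite /f /tensor_lift mulr_suml linear_sum; apply: eq_bigr => p _.
  rewrite mulr_sumr linear_sum; apply: eq_bigr => q _.
  by rewrite -scalerAl linearZ -[p.1 * (_ *: _)]scalerAr linearZ /= !regular_scaleE; ring.
have e2 : sweedler (fun x z => sweedler (fun x' z' =>
    sweedler (fun u v => sweedler (fun u' v' => T u u' v v' z z') x') x) b) a
  = f a * f b.
  transitivity (sweedler (fun x z => sweedler (fun x' z' =>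
      counit x * counit x' * (f z * f z') : k^o) b) a).
    apply: eq_tensor_lift => x y; apply: eq_tensor_lift => x' y'.
    rewrite -counitM -(convVl_fun pi) sweedlerM; last exact: bilinear_mul.
    rewrite /sweedler /tensor_lift mulr_suml; apply: eq_bigr => p _.
    rewrite mulr_suml; apply: eq_bigr => q _.
    by rewrite rmorphM.
  rewrite -[in RHS](counit_comul a) -[in RHS](counit_comul b).
  rewrite /f /tensor_lift !linear_sum mulr_suml; apply: eq_bigr => p _.
  rewrite mulr_sumr; apply: eq_bigr => q _.
  by rewrite !linearZ /= !regular_scaleE; ring.
have fl := convV_fun_linear pi; rewrite -/f in fl.
have fMl (y z z' : A) c : f ((c *: z + z') * y) = c * f (z * y) + f (z' * y).
  by rewrite mulrDl -scalerAl fl.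
have fMr (y z z' : A) c : f (y * (c *: z + z')) = c * f (y * z) + f (y * z').
  by rewrite mulrDr -scalerAr fl.
rewrite -/f -e1 -e2.
transitivity (sweedler (fun x y => sweedler (fun u v =>
    sweedler (fun x' y' => sweedler (fun u' v' => T x x' u u' v v') y') b) y) a).
  apply: eq_tensor_lift => x y; rewrite /sweedler /tensor_lift.
  exact: exchange_big.
rewrite -sweedlerA; first last.
- move=> x y c z z'; rewrite /sweedler /tensor_lift scaler_sumr -big_split /=.
  apply: eq_bigr => p _; rewrite scaler_sumr -big_split /=.
  by apply: eq_bigr => q _; rewrite /T ?(fl, fMl, fMr) !regular_scaleE; ring.
- move=> x y c z z'; rewrite /sweedler /tensor_lift scaler_sumr -big_split /=.
  apply: eq_bigr => p _; rewrite scaler_sumr -big_split /=.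
  by apply: eq_bigr => q _; rewrite /T linearP !regular_scaleE; ring.
- move=> x y c z z'; rewrite /sweedler /tensor_lift scaler_sumr -big_split /=.
  apply: eq_bigr => p _; rewrite scaler_sumr -big_split /=.
  by apply: eq_bigr => q _; rewrite /T ?(fl, fMl, fMr) !regular_scaleE; ring.
apply: eq_tensor_lift => x z.
rewrite /sweedler /tensor_lift [RHS]exchange_big /=.
apply: eq_bigr => p _.
apply: esym.
have := @sweedlerA k A k^o (fun x' u' v' => T p.1 x' p.2 u' z v') b.
rewrite /sweedler /tensor_lift; apply.
- by move=> u v c y y'; rewrite /T ?(fl, fMl, fMr) !regular_scaleE; ring.
- by move=> u v c y y'; rewrite /T linearP !regular_scaleE; ring.
- by move=> u v c y y'; rewrite /T ?(fl, fMl, fMr) !regular_scaleE; ring.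
Qed.

HB.instance Definition _ pi :=
  GRing.isMonoidMorphism.Build A k^o (convV_fun pi) (convV_fun_monoid pi).

Definition convV pi : alg_char A := convV_fun pi : {lrmorphism A -> k^o}.

Lemma convVl : left_inverse conv1 convV conv.
Proof. by move=> pi; apply: alg_char_ext => a; exact: convVl_fun. Qed.

Lemma convVr : right_inverse conv1 convV conv.
Proof. by move=> pi; apply: alg_char_ext => a; exact: convVr_fun. Qed.

HB.instance Definition _ := isGroup.Build (alg_char A)
  convA conv1l conv1r convVl convVr.

End Convolution.

(* Aut_{k-alg}(A), with (g * h)%g = g \o h. *)
Section AlgebraAutomorphisms.
Variables (k : fieldType) (A : algType k).

Record alg_aut : Type := AlgAut {
  aut_fun :> {lrmorphism A -> A};
  aut_bij : bijective aut_fun }.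

HB.instance Definition _ := gen_eqMixin alg_aut.
HB.instance Definition _ := gen_choiceMixin alg_aut.

Lemma alg_aut_ext (g h : alg_aut) : (forall a, g a = h a) -> g = h.
Proof.
case: g h => [g gb] [h hb] /= /lrmorphism_ext gh; subst h.
by rewrite (Prop_irrelevance gb hb).
Qed.

Definition aut_one : alg_aut := @AlgAut idfun (inv_bij (fun=> erefl)).

Definition aut_mul (g h : alg_aut) : alg_aut :=
  @AlgAut (g \o h) (bij_comp (aut_bij g) (aut_bij h)).

Section Inverse.
Variable g : alg_aut.

Lemma aut_inv_exists : exists h : A -> A, cancel g h /\ cancel h g.
Proof. by case: (aut_bij g) => h gh hg; exists h. Qed.

Definition aut_inv_fun : A -> A := sval (cid aut_inv_exists).

Lemma aut_invK : cancel g aut_inv_fun.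
Proof. by rewrite /aut_inv_fun; case: cid => h []. Qed.

Lemma aut_inv_funK : cancel aut_inv_fun g.
Proof. by rewrite /aut_inv_fun; case: cid => h []. Qed.

HB.instance Definition _ := GRing.isLinear.Build k A A *:%R aut_inv_fun
  (can2_linear aut_invK aut_inv_funK).
HB.instance Definition _ := GRing.isMonoidMorphism.Build A A aut_inv_fun
  (can2_monoid_morphism aut_invK aut_inv_funK).

Definition aut_inv : alg_aut :=
  @AlgAut aut_inv_fun (Bijective aut_inv_funK aut_invK).

End Inverse.

Lemma aut_mulA : associative aut_mul.
Proof. by move=> f g h; apply: alg_aut_ext. Qed.

Lemma aut_mul1g : left_id aut_one aut_mul.
Proof. by move=> g; apply: alg_aut_ext. Qed.

Lemma aut_mulg1 : right_id aut_one aut_mul.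
Proof. by move=> g; apply: alg_aut_ext. Qed.

Lemma aut_mulVg : left_inverse aut_one aut_inv aut_mul.
Proof. by move=> g; apply: alg_aut_ext => a; exact: aut_invK. Qed.

Lemma aut_mulgV : right_inverse aut_one aut_inv aut_mul.
Proof. by move=> g; apply: alg_aut_ext => a; exact: aut_inv_funK. Qed.

HB.instance Definition _ := isGroup.Build alg_aut
  aut_mulA aut_mul1g aut_mulg1 aut_mulVg aut_mulgV.

End AlgebraAutomorphisms.

Section GeneratedSubgroup.
Variables (gT : groupType).

Inductive generated (S : set gT) : gT -> Prop :=
| GenMem x of S x : generated S x
| Gen1 : generated S 1%g
| GenM x y of generated S x & generated S y : generated S (x * y)%g
| GenV x of generated S x : generated S x^-1%g.

Variable S : set gT.

Definition generated_mem : {pred gT} := fun x => `[< generated S x >].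

Definition generated_group : Type := {x : gT | generated_mem x}.

HB.instance Definition _ := [isSub of generated_group for @sval _ _].
HB.instance Definition _ := [Choice of generated_group by <:].

Lemma generated_closed : group_closed generated_mem.
Proof.
split=> [|x y]; first exact/asboolP/Gen1.
move=> /asboolP Sx /asboolP Sy.
by apply/asboolP; apply: GenM => //; exact: GenV.
Qed.

HB.instance Definition _ := SubChoice_isSubGroup.Build gT generated_mem
  generated_group generated_closed.

End GeneratedSubgroup.

Definition nonzero (k : fieldType) : Type := {x : k | x != 0}.

Section Nonzero.
Variable k : fieldType.

HB.instance Definition _ := [isSub of nonzero k for @sval _ _].
HB.instance Definition _ := [Choice of nonzero k by <:].

Implicit Types x y : nonzero k.

Lemma nonzero_mul_subproof x y : val x * val y != 0.
Proof. by rewrite mulf_neq0 ?(valP x) ?(valP y). Qed.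

Lemma nonzero_inv_subproof x : (val x)^-1 != 0.
Proof. by rewrite invr_eq0 (valP x). Qed.

Definition nonzero_one : nonzero k := Sub 1 (oner_neq0 k).
Definition nonzero_mul x y : nonzero k := Sub (val x * val y) (nonzero_mul_subproof x y).
Definition nonzero_inv x : nonzero k := Sub (val x)^-1 (nonzero_inv_subproof x).

Lemma nonzero_mulA : associative nonzero_mul.
Proof. by move=> x y z; apply: val_inj; exact: mulrA. Qed.

Lemma nonzero_mul1 : left_id nonzero_one nonzero_mul.
Proof. by move=> x; apply: val_inj; exact: mul1r. Qed.

Lemma nonzero_mulr1 : right_id nonzero_one nonzero_mul.
Proof. by move=> x; apply: val_inj; exact: mulr1. Qed.

Lemma nonzero_mulV : left_inverse nonzero_one nonzero_inv nonzero_mul.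
Proof. by move=> x; apply: val_inj; exact: mulVf (valP x). Qed.

Lemma nonzero_mulrV : right_inverse nonzero_one nonzero_inv nonzero_mul.
Proof. by move=> x; apply: val_inj; exact: mulfV (valP x). Qed.

HB.instance Definition _ := isGroup.Build (nonzero k)
  nonzero_mulA nonzero_mul1 nonzero_mulr1 nonzero_mulV nonzero_mulrV.

Lemma nonzero_mulC x y : (x * y = y * x)%g.
Proof. by apply: val_inj; exact: mulrC. Qed.

End Nonzero.

(* Homs to k^*, written additively: chi + psi is the pointwise product. *)
Definition character_group (G : groupType) (k : fieldType) : Type :=
  {multiplicative G -> nonzero k}.

HB.instance Definition _ G k := gen_eqMixin (character_group G k).
HB.instance Definition _ G k := gen_choiceMixin (character_group G k).

Definition char_val (G : groupType) (k : fieldType) (chi : character_group G k) :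
  {multiplicative G -> nonzero k} := chi.
Coercion char_val : character_group >-> Multiplicative.type.

Section CharacterGroup.
Variables (G : groupType) (k : fieldType).
Implicit Types chi psi : character_group G k.

Lemma character_ext chi psi : (forall g, chi g = psi g) -> chi = psi.
Proof.
case: chi psi => [chi [[c]]] [psi [[p]]] /= /funext cp; subst psi.
by rewrite (Prop_irrelevance c p).
Qed.

Definition character_add_fun chi psi (g : G) : nonzero k := (chi g * psi g)%g.
Definition character_opp_fun chi (g : G) : nonzero k := (chi g)^-1%g.
Definition character_zero_fun (g : G) : nonzero k := 1%g.

Lemma character_addM chi psi : {morph character_add_fun chi psi : x y / (x * y)%g}.
Proof.
move=> x y; rewrite /character_add_fun !gmulfM !mulgA; congr (_ * _)%g.
by rewrite -!mulgA; congr (_ * _)%g; exact: nonzero_mulC.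
Qed.

Lemma character_oppM chi : {morph character_opp_fun chi : x y / (x * y)%g}.
Proof.
by move=> x y; rewrite /character_opp_fun gmulfM invgM nonzero_mulC.
Qed.

Lemma character_zeroM : {morph character_zero_fun : x y / (x * y)%g}.
Proof. by move=> x y; rewrite /character_zero_fun mulg1. Qed.

HB.instance Definition _ chi psi := isMultiplicative.Build G (nonzero k)
  (character_add_fun chi psi) (character_addM chi psi).
HB.instance Definition _ chi := isMultiplicative.Build G (nonzero k)
  (character_opp_fun chi) (character_oppM chi).
HB.instance Definition _ := isMultiplicative.Build G (nonzero k)
  character_zero_fun character_zeroM.

Definition character_add chi psi : character_group G k :=
  character_add_fun chi psi : {multiplicative G -> nonzero k}.
Definition character_opp chi : character_group G k :=
  character_opp_fun chi : {multiplicative G -> nonzero k}.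
Definition character_zero : character_group G k :=
  character_zero_fun : {multiplicative G -> nonzero k}.

Lemma character_addA : associative character_add.
Proof. by move=> x y z; apply: character_ext => g; exact: mulgA. Qed.

Lemma character_addC : commutative character_add.
Proof. by move=> x y; apply: character_ext => g; exact: nonzero_mulC. Qed.

Lemma character_add0 : left_id character_zero character_add.
Proof. by move=> x; apply: character_ext => g; exact: mul1g. Qed.

Lemma character_addN : left_inverse character_zero character_opp character_add.
Proof. by move=> x; apply: character_ext => g; exact: mulVg. Qed.

HB.instance Definition _ := GRing.isZmodule.Build (character_group G k)
  character_addA character_addC character_add0 character_addN.

End CharacterGroup.

Section Winding.
Variables (k : fieldType) (A : hopfAlgType k).
Implicit Types pi rho : alg_char A.

Definition winding_fun pi (a : A) : A := sweedler (fun a1 a2 => (pi a1 : k) *: a2) a.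

Lemma bilinear_winding pi : bilinear_fun (fun a1 a2 : A => (pi a1 : k) *: a2).
Proof.
split=> [w c v v'|v c w w']; first by rewrite linearP scalerDl scalerA.
by rewrite scalerDr !scalerA mulrC.
Qed.

Lemma winding_linear pi : linear (winding_fun pi).
Proof. exact/sweedler_linear/bilinear_winding. Qed.

Lemma winding_monoid pi : monoid_morphism (winding_fun pi).
Proof.
split.
  rewrite /winding_fun sweedler1 ?rmorph1 ?scale1r //; exact: bilinear_winding.
move=> a b; rewrite /winding_fun sweedlerM; last exact: bilinear_winding.
rewrite /sweedler /tensor_lift mulr_suml; apply: eq_bigr => p _.
rewrite mulr_sumr; apply: eq_bigr => q _.
by rewrite rmorphM -scalerAl -scalerAr scalerA.
Qed.

HB.instance Definition _ pi :=
  GRing.isLinear.Build k A A *:%R (winding_fun pi) (winding_linear pi).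
HB.instance Definition _ pi :=
  GRing.isMonoidMorphism.Build A A (winding_fun pi) (winding_monoid pi).

Lemma winding_conv pi rho a :
  winding_fun pi (winding_fun rho a) = winding_fun (rho * pi)%g a.
Proof.
pose T x u v : A := (rho x : k) *: ((pi u : k) *: v).
transitivity (sweedler (fun x y => sweedler (fun u v => T x u v) y) a).
  rewrite {2}/winding_fun /sweedler {1}/tensor_lift linear_sum.
  apply: eq_bigr => p _; rewrite linearZ /= /winding_fun /sweedler /tensor_lift.
  by rewrite scaler_sumr.
rewrite -sweedlerA.
- apply: eq_tensor_lift => x z; rewrite /sweedler /tensor_lift.
  have -> : ((rho * pi)%g x : k) =
      \sum_(p <- repr (comul x)) (rho p.1 : k) * (pi p.2 : k) by [].
  by rewrite scaler_suml; apply: eq_bigr => p _; rewrite /T scalerA.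
- by move=> y z c x x'; rewrite /T linearP regular_scaleE scalerDl !scalerA mulrA.
- move=> x z c y y'; rewrite /T linearP regular_scaleE scalerDl scalerDr !scalerA.
  by congr (_ *: _ + _); ring.
- move=> x y c z z'; rewrite /T !scalerDr !scalerA.
  by congr (_ *: _ + _); ring.
Qed.

Lemma winding1 a : winding_fun 1%g a = a.
Proof. exact: counit_comul. Qed.

Lemma winding_bij pi : bijective (winding_fun pi).
Proof.
exists (winding_fun pi^-1%g) => a; rewrite winding_conv.
  by rewrite mulgV winding1.
by rewrite mulVg winding1.
Qed.

Definition winding pi : alg_aut A := @AlgAut k A (winding_fun pi) (winding_bij pi).

End Winding.

Definition winding_group (k : fieldType) (A : hopfAlgType k)
    (Pi : set (alg_char A)) : groupType :=
  generated_group [set winding pi | pi in Pi].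

Definition winding_component (k : fieldType) (A : hopfAlgType k)
    (Pi : set (alg_char A)) (chi : character_group (winding_group Pi) k) : set A :=
  [set a | forall g : winding_group Pi,
     (val g : alg_aut A) a = val (chi g) *: a].

(* The image of X ⊗ A in A ⊗ A. *)
Definition tensor_left (k : fieldType) (V W : lmodType k) (X : set V) :
    set (V ⊗ W) :=
  [set t | exists s : seq (V * W),
     (forall p, p \in s -> X p.1) /\ t = \sum_(p <- s) p.1 ⊗ p.2].

Section Grading.
Variables (k : fieldType) (A : algType k) (Gamma : zmodType).
Implicit Types (X Y : set A) (F : Gamma -> set A).

Definition is_subspace X : Prop :=
  X 0 /\ forall (c : k) a b, X a -> X b -> X (c *: a + b).

Definition product_space X Y : set A :=
  [set a | exists s : seq (A * A),
     (forall p, p \in s -> X p.1 /\ Y p.2) /\ a = \sum_(p <- s) p.1 * p.2].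

Definition direct_sum_decomposition F : Prop :=
  (forall gamma, is_subspace (F gamma)) /\
  forall a : A, exists! f : {fsfun Gamma -> A with 0},
    (forall gamma, F gamma (f gamma)) /\
    a = \sum_(gamma <- finsupp f) f gamma.

Definition algebra_grading F : Prop :=
  direct_sum_decomposition F /\
  forall gamma delta,
    product_space (F gamma) (F delta) `<=` F (gamma + delta).

Definition strong_grading F : Prop :=
  algebra_grading F /\
  forall gamma delta,
    product_space (F gamma) (F delta) = F (gamma + delta).

End Grading.

(* Main.v *)
From HB Require Import structures.
From mathcomp Require Import fingroup cyclic separable cyclotomic.
Require Import Defs.
From mathcomp Require Import all_boot all_algebra finmap.
From mathcomp Require Import boolp classical_sets cardinality.

(** The winding maps turn <<Pi>> into a finite abelian group G of algebra
    automorphisms of A (an anti-isomorphism, by [windingM] and [winding_inj]),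
    of order n invertible in k.  Everything rests on the averaging operators
      e_chi = n^-1 * sum over g in G of chi(g)^-1 g,
    which are the identity on A_chi and vanish on the other components.

    Since k contains the n-th roots of unity and every g in G satisfies
    g^n = 1, each g is diagonalizable; as G is commutative, every element of A
    is a sum of simultaneous eigenvectors ([eigen_decomposition]), and a
    nonzero simultaneous eigenvector lies in A_chi for the character chi of
    its eigenvalues.  With the e_chi this gives the direct sum.

    A winding automorphism g acts on the left leg of the coproduct only:
    Delta(g a) = (g (x) id)(Delta a), by coassociativity.  Averaging,
    Delta(e_chi a) = (e_chi (x) id)(Delta a), which for a in A_chi is (a).

    For strongness it suffices that 1 lies in A_chi A_(-chi) for every chi
    ([strong_grading_of_one]).  The characters epsilon o g of A, for g in G,
    are pairwise distinct, hence linearly independent (Dedekind), so that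
    epsilon o e_chi is not zero: some b in A_chi has epsilon(b) = 1.  By (a),
    1 = sum of b_1 S(b_2) with every b_1 in A_chi.  The degree 0 part of this
    identity is 1 = sum of b_1 e_(-chi)(S(b_2)), as wanted. *)

Set Implicit Arguments.
Unset Strict Implicit.
Unset Printing Implicit Defensive.

Import GRing.Theory.

Local Open Scope classical_set_scope.
Local Open Scope ring_scope.

(** * Orders and roots of unity *)

(** Lagrange's theorem, for a group whose finiteness is only known through an
    enumeration: such an enumeration makes it a [finGroupType]. *)
Lemma expg_size_enum (G : groupType) (s : seq G) :
  uniq s -> (forall g, g \in s) -> forall g : G, (g ^+ size s = 1)%g.
Proof.
move=> us ms g.
have s_enum : Finite.axiom s by move=> x; rewrite count_uniq_mem // ms.
pose inv_fun (n : nat) : option G := nth None (map Some s) n.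
have K : pcancel (index^~ s) inv_fun.
  by move=> x; rewrite /inv_fun (nth_map x) ?index_mem ?nth_index.
pose cM := @PCanIsCountable nat G (index^~ s) inv_fun K.
pose fM := isFinite.Build G s_enum.
pose F : finGroupType := HB.pack G cM fM.
have -> : size s = #|[set: F]%SET|.
  by rewrite cardsT cardT enumT unlock.
by apply: (@expg_cardG F [set: F]%G g); rewrite inE.
Qed.

Lemma closed_prim_root (k : closedFieldType) (n : nat) :
  n%:R != 0 :> k -> exists w : k, n.-primitive_root w.
Proof.
move=> n0.
have n_gt0 : (0 < n)%N by case: n n0 => //; rewrite eqxx.
pose p : {poly k} := 'X^n - 1; have [r Dp] := closed_field_poly_normal p.
have sz_p : size p = n.+1 by rewrite size_XnsubC.
have lp : lead_coef p = 1 by apply/eqP/monicXnsubC.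
rewrite lp scale1r in Dp.
have rn1 : all n.-unity_root r by apply/allP => z; rewrite -root_prod_XsubC -Dp.
have sz_r : (n < (size r).+1)%N.
  by rewrite -(size_prod_XsubC r id) -Dp sz_p.
have [|z] := hasP (has_prim_root n_gt0 rn1 _ sz_r); last by exists z.
by rewrite -separable_prod_XsubC -Dp separable_Xn_sub_1.
Qed.

(** * Isotypic components of a linear action of a finite abelian group *)

Section GroupAction.
Variables (k : fieldType) (V : lmodType k) (G : groupType).
Variable act : G -> {linear V -> V}.
Hypothesis act1 : forall v, act 1%g v = v.
Hypothesis actM : forall g h v, act (g * h)%g v = act g (act h v).
Implicit Types (chi psi : character_group G k) (g h : G) (v : V).

Definition isotypic chi : set V :=
  [set v | forall g, act g v = val (chi g) *: v].

Lemma isotypic_subspace chi :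
  isotypic chi 0 /\
  forall (c : k) v w, isotypic chi v -> isotypic chi w ->
    isotypic chi (c *: v + w).
Proof.
split=> [g|c v w Vv Vw g]; first by rewrite linear0 scaler0.
by rewrite linearP Vv Vw scalerDr !scalerA mulrC.
Qed.

Lemma isotypicZ chi c v : isotypic chi v -> isotypic chi (c *: v).
Proof.
have [V0 VP] := isotypic_subspace chi.
by move=> Vv; rewrite -[c *: v]addr0; apply: VP.
Qed.

Lemma isotypic_sum chi (I : eqType) (r : seq I) (F : I -> V) :
  (forall i, i \in r -> isotypic chi (F i)) -> isotypic chi (\sum_(i <- r) F i).
Proof.
have [V0 VP] := isotypic_subspace chi.
move=> VF; rewrite big_seq; elim/big_ind: _ => [//|v w Vv Vw|//].
by rewrite -[v]scale1r; apply: VP.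
Qed.

(** The eigenvalues of a nonzero simultaneous eigenvector determine the
    character. *)
Lemma isotypic_unique chi psi v :
  isotypic chi v -> isotypic psi v -> v != 0 -> chi = psi.
Proof.
move=> Vchi Vpsi v0; apply: character_ext => g; apply: val_inj; apply/eqP.
rewrite -subr_eq0; have := Vchi g; rewrite Vpsi => /eqP.
by rewrite eq_sym -subr_eq0 -scalerBl scaler_eq0 (negPf v0) orbF.
Qed.

(** The eigenvalues of a simultaneous eigenvector are nonzero, because the
    group acts by invertible maps, and they multiply as the group elements
    do. *)
Lemma eigenvector_isotypic v : v != 0 ->
  (forall g, exists c : k, act g v = c *: v) -> exists chi, isotypic chi v.
Proof.
move=> v0 /choice [c cP].
have inj (a b : k) : a *: v = b *: v -> a = b.
  move/eqP; rewrite -subr_eq0 -scalerBl scaler_eq0 (negPf v0) orbF subr_eq0.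
  by move/eqP.
have c0 g : c g != 0.
  apply: contraNneq v0 => cg0.
  by rewrite -[v]act1 -(mulVg g) actM cP cg0 scale0r linear0.
pose f g : nonzero k := Sub (c g) (c0 g).
have fM : {morph f : g h / (g * h)%g}.
  move=> g h; apply: val_inj; apply: inj; rewrite /= -cP actM cP linearZ /=.
  by rewrite cP scalerA mulrC.
pose M := isMultiplicative.Build G (nonzero k) f fM.
pose chi : {multiplicative G -> nonzero k} := HB.pack f M.
by exists (chi : character_group G k) => g; rewrite cP.
Qed.

Section FiniteGroup.
Variable s : seq G.
Hypothesis s_uniq : uniq s.
Hypothesis s_enum : forall g, g \in s.
Hypothesis size_s_neq0 : (size s)%:R != 0 :> k.

(** The idempotent of the group algebra attached to the character [chi]. *)
Definition isotypic_proj chi v : V :=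
  (size s)%:R^-1 *: \sum_(g <- s) (val (chi g))^-1 *: act g v.

Lemma isotypic_proj_linear chi : linear (isotypic_proj chi).
Proof.
move=> c v w; rewrite /isotypic_proj scalerA mulrC -scalerA -scalerDr.
congr (_ *: _); rewrite scaler_sumr -big_split; apply: eq_bigr => g _ /=.
by rewrite linearP scalerDr !scalerA mulrC.
Qed.

HB.instance Definition _ chi := GRing.isLinear.Build k V V *:%R
  (isotypic_proj chi) (isotypic_proj_linear chi).

Lemma perm_mulg_enum h : perm_eq s [seq (h * g)%g | g <- s].
Proof.
apply: uniq_perm => [//||g].
  by rewrite map_inj_uniq // => x y; apply: mulgI.
rewrite s_enum; apply/esym/mapP; exists (h^-1 * g)%g => //.
by rewrite mulVKg.
Qed.

(** Applying h permutes the terms of the average, up to the factor chi(h). *)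
Lemma isotypic_proj_in chi v : isotypic chi (isotypic_proj chi v).
Proof.
move=> h; rewrite /isotypic_proj linearZ linear_sum /=.
rewrite [RHS]scalerA mulrC -scalerA; congr (_ *: _).
rewrite scaler_sumr [RHS](perm_big _ (perm_mulg_enum h)) big_map /=.
apply: eq_bigr => g _; rewrite linearZ /= -actM scalerA gmulfM /= invfM.
by rewrite mulrA mulfV ?mul1r // (valP (chi h)).
Qed.

Lemma isotypic_proj_id chi v : isotypic chi v -> isotypic_proj chi v = v.
Proof.
move=> Vv; rewrite /isotypic_proj.
rewrite (eq_bigr (fun=> v)); last first.
  by move=> g _; rewrite Vv scalerA mulVf ?scale1r // (valP (chi g)).
rewrite big_const_seq count_predT iter_addr_0 -scaler_nat scalerA.
by rewrite mulVf ?scale1r.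
Qed.

(** The projection of v to the chi-component is a multiple of v, so it lies in
    two distinct components. *)
Lemma isotypic_proj_neq chi psi v :
  isotypic psi v -> psi != chi -> isotypic_proj chi v = 0.
Proof.
move=> Vv; apply: contra_neq_eq => p0.
apply: (@isotypic_unique _ _ (isotypic_proj chi v)) => //; last first.
  exact: isotypic_proj_in.
apply: isotypicZ; apply: isotypic_sum => g _.
by rewrite Vv; do 2!apply: isotypicZ.
Qed.

Section Decomposition.
Hypothesis mulgC : forall g h : G, (g * h = h * g)%g.
Variable w : k.
Hypothesis w_prim : (size s).-primitive_root w.

Let n := size s.

(** An average over the powers of g, projecting to the eigenspace of g for the
    eigenvalue w^i: w is an n-th root of unity and g^n = 1. *)
Definition eigen_proj g (i : nat) v : V :=
  n%:R^-1 *: \sum_(0 <= j < n) (w ^+ (i * j))^-1 *: act (g ^+ j)%g v.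

Lemma eigen_proj_eigen g i v :
  act g (eigen_proj g i v) = w ^+ i *: eigen_proj g i v.
Proof.
have w0 : w != 0.
  by rewrite (prim_root_eq0 w_prim) -lt0n (prim_order_gt0 w_prim).
pose F j := (w ^+ (i * j))^-1 *: act (g ^+ j)%g v.
have shift : \sum_(0 <= j < n) F j.+1 = \sum_(0 <= j < n) F j.
  apply: (@addrI _ (F 0)); rewrite -big_nat_recl // big_nat_recr //= addrC.
  congr (_ + _); rewrite /F muln0 expr0 expg0 (expg_size_enum s_uniq s_enum).
  by rewrite mulnC exprM (prim_expr_order w_prim) expr1n.
rewrite /eigen_proj linearZ linear_sum /= [RHS]scalerA mulrC -scalerA.
congr (_ *: _); rewrite -shift scaler_sumr; apply: eq_bigr => j _.
rewrite /F linearZ /= -actM -expgS scalerA mulnS exprD invfM mulrA.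
by rewrite mulfV ?mul1r // expf_neq0.
Qed.

Lemma eigen_proj_act g i h v :
  act h (eigen_proj g i v) = eigen_proj g i (act h v).
Proof.
rewrite /eigen_proj linearZ linear_sum /=; congr (_ *: _).
by apply: eq_bigr => j _; rewrite linearZ -!actM mulgC.
Qed.

Lemma eigen_projZ g i c v : eigen_proj g i (c *: v) = c *: eigen_proj g i v.
Proof.
rewrite /eigen_proj [RHS]scalerA [c * _]mulrC -scalerA [in RHS]scaler_sumr.
congr (_ *: _); apply: eq_bigr => j _.
by rewrite linearZ !scalerA [c * _]mulrC.
Qed.

Lemma sum_eigen_proj g v : \sum_(0 <= i < n) eigen_proj g i v = v.
Proof.
have n_gt0 : (0 < n)%N := prim_order_gt0 w_prim.
rewrite /eigen_proj -scaler_sumr exchange_big /=.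
(* The terms with 0 < j vanish: the powers of x = w^-j sum to zero because
   x^n = 1 and x <> 1. *)
rewrite big_ltn // [X in _ + X]big_nat [X in _ + X]big1 ?addr0; last first.
  move=> j /andP[j0 jn]; rewrite -scaler_suml.
  have x1 : (w ^+ j)^-1 != 1.
    rewrite invr_eq1 -(prim_order_dvd w_prim) gtnNdvd //.
  suff -> : \sum_(0 <= i < n) (w ^+ (i * j))^-1 = 0 by rewrite scale0r.
  apply/eqP; have /eqP := subrX1 (w ^+ j)^-1 n.
  rewrite exprVn -exprM mulnC exprM (prim_expr_order w_prim) expr1n invr1 subrr.
  rewrite eq_sym mulf_eq0 subr_eq0 (negPf x1) /= big_mkord.
  by under eq_bigr do rewrite exprVn -exprM mulnC.
under eq_bigr do rewrite muln0 expr0 invr1 scale1r expg0 act1.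
by rewrite sumr_const_nat subn0 -scaler_nat scalerA mulVf ?scale1r.
Qed.

(** Simultaneous diagonalization, by induction on the list [l]: splitting each
    summand by the projections [eigen_proj g] keeps it an eigenvector of the
    elements already treated, since these commute with g. *)
Lemma eigen_decomposition (l : seq G) v : exists r : seq V,
  (forall u g, u \in r -> g \in l -> exists c : k, act g u = c *: u) /\
  v = \sum_(u <- r) u.
Proof.
elim: l => [|g l [r [rP ->]]].
  by exists [:: v]; split=> //; rewrite big_seq1.
exists [seq eigen_proj g i u | u <- r, i <- index_iota 0 n]; split.
  move=> _ h /allpairsP[[u i] [ur _ ->]] /=; rewrite inE => /predU1P[->|hl].
    by exists (w ^+ i); rewrite eigen_proj_eigen.
  have [c uc] := rP _ _ ur hl; exists c.
  by rewrite eigen_proj_act uc eigen_projZ.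
rewrite big_allpairs_dep; apply: eq_bigr => u _.
by rewrite sum_eigen_proj.
Qed.

(** The set [X] gathers the characters met in a decomposition of v into
    simultaneous eigenvectors for the whole group. *)
Lemma isotypic_decomposition v : exists X : {fset character_group G k},
  (forall chi, chi \notin X -> isotypic_proj chi v = 0) /\
  v = \sum_(chi <- X) isotypic_proj chi v.
Proof.
have [r [rP ->]] := eigen_decomposition s v.
have /choice [c cP] : forall u, exists chi, u \in r -> isotypic chi u.
  move=> u; case: (eqVneq u 0) => [->|u0].
    by exists 0 => _; apply: (isotypic_subspace _).1.
  case: (boolP (u \in r)) => [ur|_]; last by exists 0.
  have [|chi Vu] := eigenvector_isotypic u0; last by exists chi.
  by move=> g; apply: rP.
exists [fset c u | u in r]%fset; split=> [chi chiX|].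
  rewrite linear_sum big_seq big1 //= => u ur.
  apply: isotypic_proj_neq (cP u ur) _; apply: contraNneq chiX => <-.
  exact: in_imfset.
under [RHS]eq_bigr do rewrite linear_sum.
rewrite exchange_big /= [LHS]big_seq [RHS]big_seq; apply: eq_bigr => u ur.
rewrite (bigD1_seq (c u)) ?fset_uniq ?in_imfset //=.
rewrite isotypic_proj_id ?big1 ?addr0 //; last exact: cP.
by move=> chi chic; apply: isotypic_proj_neq (cP u ur) _; rewrite eq_sym.
Qed.

End Decomposition.
End FiniteGroup.
End GroupAction.

(** * Gradings defined by automorphisms *)

Section AutomorphismGrading.
Variables (k : fieldType) (A : algType k).

(** If 1 = sum of x_i y_i with x_i of degree gamma and y_i of degree - gamma,
    then a = sum of x_i (y_i a) factors any a of degree gamma + delta. *)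
Lemma strong_grading_of_one (Gamma : zmodType) (F : Gamma -> set A) :
  algebra_grading F ->
  (forall gamma, product_space (F gamma) (F (- gamma)) 1) ->
  strong_grading F.
Proof.
move=> Fgr F1; split=> // gamma delta; apply/seteqP; split; first exact: Fgr.2.
move=> a Fa; have [s [sF e1]] := F1 gamma.
exists [seq (p.1, p.2 * a) | p <- s]; split=> [_ /mapP[p ps ->] /=|].
  have [Fp1 Fp2] := sF p ps; split=> //.
  rewrite -[delta](addKr gamma); apply: Fgr.2.
  exists [:: (p.2, a)]; rewrite big_seq1; split=> // q.
  by rewrite inE => /eqP ->.
rewrite big_map -[a in LHS]mul1r e1 mulr_suml.
by apply: eq_bigr => p _; rewrite mulrA.
Qed.

Variables (G : groupType) (act : G -> alg_aut A).
Hypothesis actM : forall g h a, act (g * h)%g a = act g (act h a).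
Implicit Types chi psi : character_group G k.

Lemma isotypicM chi psi a b :
  isotypic act chi a -> isotypic act psi b -> isotypic act (chi + psi) (a * b).
Proof.
by move=> Aa Ab g; rewrite rmorphM /= Aa Ab -scalerAl -scalerAr scalerA.
Qed.

(** The degree 0 part of a b, for a of degree chi, involves only the part of b
    of degree - chi. *)
Lemma isotypic_proj0M s chi a b : isotypic act chi a ->
  isotypic_proj act s 0 (a * b) = a * isotypic_proj act s (- chi) b.
Proof.
move=> Aa; rewrite /isotypic_proj -scalerAr; congr (_ *: _).
rewrite mulr_sumr; apply: eq_bigr => g _.
by rewrite rmorphM /= Aa -scalerAl -scalerAr invrK invr1 scale1r.
Qed.

End AutomorphismGrading.

Section IsotypicGrading.
Variables (k : closedFieldType) (A : algType k).
Variables (G : groupType) (act : G -> alg_aut A).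
Hypothesis act1 : forall a, act 1%g a = a.
Hypothesis actM : forall g h a, act (g * h)%g a = act g (act h a).
Hypothesis mulgC : forall g h : G, (g * h = h * g)%g.
Variable s : seq G.
Hypothesis s_uniq : uniq s.
Hypothesis s_enum : forall g, g \in s.
Hypothesis size_s_neq0 : (size s)%:R != 0 :> k.

Lemma isotypic_direct_sum :
  direct_sum_decomposition (fun chi => isotypic act chi).
Proof.
split=> [chi|a]; first exact: isotypic_subspace.
have [w w_prim] := closed_prim_root size_s_neq0.
have [X [XP aE]] := isotypic_decomposition act1 actM s_uniq s_enum size_s_neq0
  mulgC w_prim a.
pose f : {fsfun character_group G k -> A with 0} :=
  [fsfun chi in X => isotypic_proj act s chi a].
have fE chi : f chi = isotypic_proj act s chi a.
  by rewrite fsfunE; case: ifPn => // /XP.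
exists f; split=> [|f' [f'A aE']].
  split=> [chi|]; first by rewrite fE; exact: isotypic_proj_in.
  rewrite [LHS]aE (big_fset_incl _ (finsupp_sub _ _ _)) /=; last first.
    by move=> chi _; rewrite memNfinsupp => /eqP.
  by apply: eq_bigr => chi _; rewrite fE.
apply/fsfunP => chi; rewrite fE aE' linear_sum /=.
case: (boolP (chi \in finsupp f')) => [chif|].
  rewrite (bigD1_seq chi) ?fset_uniq //= isotypic_proj_id // big1 ?addr0 //.
  by move=> psi; apply: isotypic_proj_neq.
move=> chif; rewrite (fsfun_dflt chif) big_seq big1 // => psi psif.
apply: (isotypic_proj_neq actM s_uniq s_enum (f'A psi)).
by apply: contraNneq chif => <-.
Qed.

Lemma isotypic_grading : algebra_grading (fun chi => isotypic act chi).
Proof.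
split=> [|chi psi _ [r [rP ->]]]; first exact: isotypic_direct_sum.
by apply: isotypic_sum => p /rP[Ap1 Ap2]; apply: isotypicM.
Qed.

End IsotypicGrading.

(** * Independence of characters and winding automorphisms *)

(** Dedekind's theorem.  Comparing the relation at b a with pi0(b) times the
    relation at a eliminates the first character pi0; by induction
    c(pi) (pi(b) - pi0(b)) = 0 for the others, where b may be chosen to separate
    pi from pi0. *)
Lemma alg_char_independent (k : fieldType) (A : algType k)
    (r : seq (alg_char A)) (c : alg_char A -> k) : uniq r ->
  (forall a, \sum_(pi <- r) c pi * pi a = 0) -> forall pi, pi \in r -> c pi = 0.
Proof.
elim: r c => [//|pi0 r IH] c /= /andP[pi0r ur] cP.
have cr pi : pi \in r -> c pi = 0.
  move=> pir; have /asboolPn/existsp_asboolPn[b nb] : ~ (pi =1 pi0).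
    move=> /lrmorphism_ext e; move: pi0r.
    by rewrite -(e : pi = pi0) pir.
  have d0 : (pi b : k) - pi0 b != 0 by rewrite subr_eq0; apply/eqP.
  apply: (mulIf d0); rewrite mul0r.
  apply: (IH (fun pi => c pi * ((pi b : k) - pi0 b)) ur _ pi pir) => a.
  transitivity (\sum_(rho <- pi0 :: r) c rho * rho (b * a)
    - (pi0 b : k) * \sum_(rho <- pi0 :: r) c rho * rho a).
    rewrite mulr_sumr -sumrB big_cons rmorphM mulrCA subrr add0r.
    apply: eq_bigr => rho _.
    by rewrite rmorphM mulrBr mulrBl !mulrA [_ * c rho]mulrC.
  by rewrite !cP mulr0 subr0.
move=> pi; rewrite inE => /predU1P[->|]; last exact: cr.
have := cP 1; rewrite big_cons rmorph1 mulr1 big_seq big1 ?addr0 //.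
by move=> rho /cr ->; rewrite mul0r.
Qed.

Section WindingGroup.
Variables (k : fieldType) (A : hopfAlgType k).
Implicit Types pi rho : alg_char A.

(** The winding automorphism of pi determines pi. *)
Lemma counit_winding pi a : counit (winding pi a) = pi a.
Proof.
rewrite -[in RHS](comul_counit a) /= /winding_fun /sweedler /tensor_lift.
rewrite !linear_sum; apply: eq_bigr => p _.
by rewrite !linearZ /= !regular_scaleE mulrC.
Qed.

Lemma winding_inj : injective (@winding k A).
Proof.
move=> pi rho e; apply: lrmorphism_ext => a.
by rewrite -!counit_winding e.
Qed.

Lemma windingM pi rho : winding (pi * rho)%g = (winding rho * winding pi)%g.
Proof. by apply: alg_aut_ext => a; rewrite /= winding_conv. Qed.

Lemma winding_one : winding (1%g : alg_char A) = 1%g.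
Proof. by apply: alg_aut_ext => a; exact: winding1. Qed.

Lemma windingV pi : winding pi^-1%g = (winding pi)^-1%g.
Proof.
by apply: (mulgI (winding pi)); rewrite mulgV -windingM mulVg winding_one.
Qed.

(** The windings of a subgroup form a subgroup, as [winding] reverses
    products. *)
Lemma generated_winding (Pi : set (alg_char A)) :
  generated [set winding pi | pi in Pi] = [set winding pi | pi in generated Pi].
Proof.
apply/seteqP; split=> g.
  elim=> {g} [_ [pi Pipi <-]| |g h _ [pi Hpi <-] _ [rho Hrho <-]
    |g _ [pi Hpi <-]].
  - by exists pi => //; apply: GenMem.
  - by exists 1%g; [exact: Gen1 | exact: winding_one].
  - by exists (rho * pi)%g; [exact: GenM | exact: windingM].
  - by exists pi^-1%g; [exact: GenV | exact: windingV].
case=> pi Hpi <- {g}.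
elim: Hpi => { pi } [pi Pipi| |pi rho _ Gpi _ Grho|pi _ Gpi].
- by apply: GenMem; exists pi.
- by rewrite winding_one; exact: Gen1.
- by rewrite windingM; exact: GenM.
- by rewrite windingV; exact: GenV.
Qed.

(** Coassociativity: the coproduct of pi(a_1) a_2 is pi(a_1) a_2 (x) a_3. *)
Lemma comul_winding pi a :
  comul (winding pi a) = sweedler (fun x y => winding pi x ⊗ y) a.
Proof.
pose T (x u v : A) : A ⊗ A := (pi x : k) *: (u ⊗ v).
have [tl tr] := pure_tensor_bilinear A A.
transitivity (sweedler (fun x y => sweedler (fun u v => T x u v) y) a).
  rewrite /= /winding_fun /sweedler {1}/tensor_lift linear_sum.
  apply: eq_bigr => p _; rewrite linearZ /= [in LHS](tensor_sumE (comul p.2)).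
  by rewrite scaler_sumr.
rewrite -sweedlerA.
- apply: eq_tensor_lift => x y; rewrite /= /winding_fun /sweedler /tensor_lift.
  rewrite (linearP_sum (tl y)); apply: eq_bigr => p _.
  by rewrite (linearP_scale (tl y)).
- by move=> y z c x x'; rewrite /T linearP regular_scaleE scalerDl !scalerA.
- by move=> x z c y y'; rewrite /T tl scalerDr !scalerA mulrC.
- by move=> x y c z z'; rewrite /T tr scalerDr !scalerA mulrC.
Qed.

Variable Pi : set (alg_char A).

Definition winding_act (g : winding_group Pi) : alg_aut A := val g.

Lemma winding_actM g h a :
  winding_act (g * h)%g a = winding_act g (winding_act h a).
Proof. by []. Qed.

Lemma winding_actP g : exists2 pi, generated Pi pi & winding pi = winding_act g.
Proof.
have : generated [set winding pi | pi in Pi] (winding_act g).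
  by apply/asboolP/(valP g).
by rewrite generated_winding.
Qed.

Lemma winding_group_mulC :
  (forall pi rho, generated Pi pi -> generated Pi rho ->
    (pi * rho = rho * pi)%g) ->
  forall g h : winding_group Pi, (g * h = h * g)%g.
Proof.
move=> Pi_abelian g h; apply: val_inj.
change (winding_act g * winding_act h = winding_act h * winding_act g)%g.
have [pi Hpi <-] := winding_actP g; have [rho Hrho <-] := winding_actP h.
by rewrite -!windingM Pi_abelian.
Qed.

(** The default value 1 is never reached for pi in <<Pi>>. *)
Definition winding_elt pi : winding_group Pi := insubd 1%g (winding pi).

Lemma winding_act_elt pi :
  generated Pi pi -> winding_act (winding_elt pi) = winding pi.
Proof.
move=> Hpi; rewrite /winding_act insubdK //; apply/asboolP.
rewrite generated_winding.
by exists pi.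
Qed.

Definition winding_enum : seq (winding_group Pi) :=
  [seq winding_elt pi | pi <- fset_set (generated Pi)].

Hypothesis Pi_finite : finite_set (generated Pi).

Lemma mem_generated pi : pi \in fset_set (generated Pi) -> generated Pi pi.
Proof. by rewrite in_fset_set // inE. Qed.

Lemma winding_enum_uniq : uniq winding_enum.
Proof.
rewrite map_inj_in_uniq ?fset_uniq // => pi rho /mem_generated Hpi.
move=> /mem_generated Hrho /(congr1 winding_act).
by rewrite !winding_act_elt // => /winding_inj.
Qed.

Lemma mem_winding_enum g : g \in winding_enum.
Proof.
have [pi Hpi e] := winding_actP g; apply/mapP; exists pi.
  by rewrite in_fset_set // inE.
by apply: val_inj; rewrite -[LHS]e -(winding_act_elt Hpi).
Qed.

Lemma size_winding_enum : size winding_enum = #|` fset_set (generated Pi)|.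
Proof. by rewrite size_map. Qed.

Lemma comul_winding_group g a :
  comul (winding_act g a) = sweedler (fun x y => winding_act g x ⊗ y) a.
Proof.
have [pi _ <-] := winding_actP g; exact: comul_winding.
Qed.

(** [comul_winding_group] averaged over the group; this carries part (a). *)
Lemma comul_isotypic_proj chi a :
  comul (isotypic_proj winding_act winding_enum chi a) =
  sweedler (fun x y => isotypic_proj winding_act winding_enum chi x ⊗ y) a.
Proof.
have [tl _] := pure_tensor_bilinear A A.
transitivity ((size winding_enum)%:R^-1 *: \sum_(g <- winding_enum)
    (val (chi g))^-1 *: sweedler (fun x y => winding_act g x ⊗ y) a).
  rewrite /isotypic_proj linearZ linear_sum; congr (_ *: _).
  by apply: eq_bigr => g _; rewrite linearZ -comul_winding_group.
rewrite /sweedler /tensor_lift /isotypic_proj.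
under eq_bigr do rewrite scaler_sumr.
rewrite exchange_big scaler_sumr; apply: eq_bigr => p _ /=.
rewrite (linearP_scale (tl p.2)) (linearP_sum (tl p.2)); congr (_ *: _).
by apply: eq_bigr => g _; rewrite (linearP_scale (tl p.2)).
Qed.

Hypothesis size_neq0 : (size winding_enum)%:R != 0 :> k.

Lemma comul_winding_component (chi : character_group (winding_group Pi) k) a :
  winding_component chi a ->
  tensor_left (winding_component chi) (comul a).
Proof.
move=> Aa; exists [seq (isotypic_proj winding_act winding_enum chi p.1, p.2)
  | p <- repr (comul a)]; split.
  move=> _ /mapP[p _ ->]; apply: isotypic_proj_in => //.
    exact: winding_enum_uniq.
  exact: mem_winding_enum.
by rewrite big_map -[in LHS](isotypic_proj_id size_neq0 Aa) comul_isotypic_proj.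
Qed.

(** Otherwise epsilon vanishes on A_chi, which contains every e_chi a; but
    n epsilon(e_chi a) is the combination of the pi(a), pi in <<Pi>>, whose
    coefficients are the inverses of the values of chi, so these coefficients
    would all be zero. *)
Lemma winding_component_counit (chi : character_group (winding_group Pi) k) :
  exists2 a : A, winding_component chi a & counit a = 1.
Proof.
apply: contrapT => noa.
pose c pi := (val (chi (winding_elt pi)))^-1.
have c0 : c 1%g = 0.
  apply: (alg_char_independent (fset_uniq (fset_set (generated Pi)))).
    move=> a; pose b := isotypic_proj winding_act winding_enum chi a.
    have Ab : winding_component chi b.
      exact: (isotypic_proj_in winding_actM winding_enum_uniq mem_winding_enum).
    have /eqP : counit b = 0.
      apply: contrapT => /eqP nz; apply: noa.
      exists ((counit b : k)^-1 *: b); first exact: isotypicZ.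
      by rewrite linearZ /= regular_scaleE mulVf.
    rewrite /b /isotypic_proj linearZ linear_sum mulf_eq0 invr_eq0.
    rewrite (negPf size_neq0) /= big_map big_seq => /eqP e0.
    rewrite -[RHS]e0 big_seq; apply: eq_bigr => pi /mem_generated Hpi.
    by rewrite linearZ winding_act_elt // counit_winding.
  by rewrite in_fset_set // inE; exact: Gen1.
by have /eqP := c0; rewrite invr_eq0 (negPf (valP (chi _))).
Qed.

(** The degree 0 part of the antipode identity for an element of A_chi of
    counit 1. *)
Lemma one_winding_component_prod (chi : character_group (winding_group Pi) k) :
  product_space (winding_component chi) (winding_component (- chi)) (1 : A).
Proof.
have [b Ab b1] := winding_component_counit chi.
have [s [sA sE]] := comul_winding_component Ab.
pose P := isotypic_proj winding_act winding_enum (- chi).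
have mulS : bilinear_fun (fun x y : A => x * antipode y).
  split=> [w d v v'|v d w w']; first by rewrite mulrDl scalerAl.
  by rewrite linearP mulrDr scalerAr.
exists [seq (p.1, P (antipode p.2)) | p <- s].
split=> [_ /mapP[p ps ->] /=|].
  split; first exact: sA.
  exact: (isotypic_proj_in winding_actM winding_enum_uniq mem_winding_enum).
have one_inv : isotypic winding_act 0 1 by move=> g; rewrite rmorph1 scale1r.
have bE : \sum_(p <- s) p.1 * antipode p.2 = 1.
  rewrite -[RHS]scale1r -b1 -antipoder sE.
  rewrite (linearP_sum (tensor_lift_linear mulS)).
  by apply: eq_bigr => p _; rewrite tensor_lift_pure.
rewrite big_map -[LHS](isotypic_proj_id size_neq0 one_inv) -bE linear_sum /=.
rewrite big_seq [RHS]big_seq; apply: eq_bigr => p ps.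
by rewrite (isotypic_proj0M _ _ (sA p ps)).
Qed.

End WindingGroup.

Theorem proposition2p2 (k : closedFieldType) (A : hopfAlgType k)
    (antipode_bij : bijective (@antipode k A))
    (Pi : set (alg_char A))
    (Pi_finite : finite_set (generated Pi))
    (Pi_abelian : forall pi rho, generated Pi pi -> generated Pi rho ->
      (pi * rho = rho * pi)%g)
    (Pi_coprime : forall p, p \in [pchar k] ->
      coprime #|` fset_set (generated Pi)| p) :
  (forall chi : character_group (winding_group Pi) k,
     [set comul a | a in winding_component chi] `<=`
       tensor_left (winding_component chi)) /\
  strong_grading
    (fun chi : character_group (winding_group Pi) k => winding_component chi).
Proof.
have size_neq0 : (size (winding_enum Pi))%:R != 0 :> k.
  have n_gt0 : (0 < size (winding_enum Pi))%N.
    by case: winding_enum (mem_winding_enum Pi_finite 1%g).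
  apply/negP => n0; have [p p_char] := natf0_pchar n_gt0 n0.
  have := Pi_coprime p p_char; rewrite -size_winding_enum coprime_sym.
  by rewrite prime_coprime ?(pcharf_prime p_char) // (dvdn_pcharf p_char) n0.
split=> [chi _ [a Aa <-]|]; first exact: comul_winding_component.
apply: strong_grading_of_one; last exact: one_winding_component_prod.
apply: (@isotypic_grading k A (winding_group Pi) (@winding_act k A Pi) _ _ _
  (winding_enum Pi)) => //.
- exact: winding_group_mulC.
- exact: winding_enum_uniq.
- exact: mem_winding_enum.
Qed.
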